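(* Let $\mathbb{K}$ be a field, $S=\mathbb{K}[x_1,\dots,x_n]$, and let $I\subsetneq S$ be a weakly polymatroidal monomial ideal. Then $\operatorname{depth}(S/I)\leq \operatorname{sdepth}(S/I)$, i.e. $S/I$ satisfies Stanley's conjecture.
   Context: For a monomial ideal $I$ let $G(I)$ be its set of minimal monomial generators. $I$ is called weakly polymatroidal if for every two monomials $u=x_1^{a_1}\cdots x_n^{a_n}$ and $v=x_1^{b_1}\cdots x_n^{b_n}$ in $G(I)$ such that $a_1=b_1,\dots,a_{t-1}=b_{t-1}$ and $a_t>b_t$ for some $t$, there exists $j>t$ such that $x_t(v/x_j)\in I$. For a finitely generated $\mathbb{Z}^n$-graded $S$-module $M$: a Stanley space is a $\mathbb{K}$-subspace $u\mathbb{K}[Z]$, with $u\in M$ homogeneous and $Z\subseteq\{x_1,\dots,x_n\}$, which is a free $\mathbb{K}[Z]$-module, of dimension $|Z|$; a Stanley decomposition of $M$ is a decomposition of $M$ as a finite direct sum of Stanley spaces (as $\mathbb{K}$-vector spaces); its Stanley depth is the minimum dimension of its Stanley spaces; $\operatorname{sdepth}(M)$ is the maximum Stanley depth over all Stanley decompositions of $M$. *)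

(* Defs.v *)
From HB Require Import structures.
From mathcomp Require Import all_boot all_order all_algebra.
From mathcomp Require Export mpoly.
Set Implicit Arguments. Unset Strict Implicit. Unset Printing Implicit Defensive.
Import GRing.Theory.
Local Open Scope ring_scope.

Definition in_ideal (K : fieldType) (n : nat) (gs : seq {mpoly K[n]})
    (p : {mpoly K[n]}) : Prop :=
  exists cs : seq {mpoly K[n]},
    size cs = size gs /\ p = \sum_(i < size gs) cs`_i * gs`_i.

Definition mon_gens (K : fieldType) (n : nat) (G : seq 'X_{1..n})
  : seq {mpoly K[n]} := [seq 'X_[g] | g <- G].

Definition mon_in (K : fieldType) (n : nat) (G : seq 'X_{1..n}) (m : 'X_{1..n})
  : Prop := in_ideal (mon_gens K G) 'X_[m].

Definition minimal_gens (n : nat) (G : seq 'X_{1..n}) : Prop :=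
  uniq G /\ forall g h, g \in G -> h \in G -> lem g h -> g = h.

(* Weakly polymatroidal (w.r.t. G = G(I)); for v = x^b, v/x_j requires b_j > 0. *)
Definition weakly_polymatroidal (K : fieldType) (n : nat) (G : seq 'X_{1..n})
  : Prop :=
  forall u v : 'X_{1..n}, u \in G -> v \in G ->
  forall t : 'I_n,
    (forall i : 'I_n, (i < t)%N -> u i = v i) -> (v t < u t)%N ->
    exists j : 'I_n, [/\ (t < j)%N, (0 < v j)%N &
      mon_in K G (mnm_add (mnm_sub v (mnm1 j)) (mnm1 t))].

Definition nzd_mod (K : fieldType) (n : nat) (gs : seq {mpoly K[n]})
    (f : {mpoly K[n]}) : Prop :=
  forall p, in_ideal gs (f * p) -> in_ideal gs p.

Fixpoint regular_aux (K : fieldType) (n : nat) (gs : seq {mpoly K[n]})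
    (fs : seq {mpoly K[n]}) : Prop :=
  match fs with
  | [::] => True
  | f :: fs' => f@_(0%MM) = 0 /\ nzd_mod gs f /\ regular_aux (rcons gs f) fs'
  end.

(* fs is an S/I-regular sequence in m: each f_i has zero constant term, f_i is a
   non-zero-divisor on S/(I + (f_1,...,f_{i-1})), and (S/I)/(fs)(S/I) <> 0. *)
Definition regular_seq (K : fieldType) (n : nat) (G : seq 'X_{1..n})
    (fs : seq {mpoly K[n]}) : Prop :=
  regular_aux (mon_gens K G) fs /\ ~ in_ideal (mon_gens K G ++ fs) 1.

Definition depth_ge (K : fieldType) (n : nat) (G : seq 'X_{1..n}) (r : nat)
  : Prop := exists fs : seq {mpoly K[n]}, size fs = r /\ regular_seq G fs.

Definition supported_in (n : nat) (w : 'X_{1..n}) (Z : {set 'I_n}) : bool :=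
  [forall i : 'I_n, (i \notin Z) ==> (w i == 0%N)].

(* A Stanley space x^u K[Z] of S/I (u a nonzero homogeneous element, i.e. the
   class of a monomial x^u up to a nonzero scalar); free over K[Z] means
   x^u * x^w is not in I for every monomial x^w of K[Z]. *)
Definition stanley_space (K : fieldType) (n : nat) (G : seq 'X_{1..n})
    (uZ : 'X_{1..n} * {set 'I_n}) : Prop :=
  forall w, supported_in w uZ.2 -> ~ mon_in K G (mnm_add uZ.1 w).

(* A Stanley decomposition of S/I: the K-vector space S/I (with basis the
   classes of monomials not in I) is the direct sum of the Stanley spaces,
   i.e. every monomial x^m not in I lies in exactly one x^u K[Z]. *)
Definition stanley_decomp (K : fieldType) (n : nat) (G : seq 'X_{1..n})
    (D : seq ('X_{1..n} * {set 'I_n})) : Prop :=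
  (forall uZ, uZ \in D -> stanley_space K G uZ) /\
  forall m : 'X_{1..n}, ~ mon_in K G m ->
    exists! k : 'I_(size D),
      exists w, supported_in w (nth (0%MM, set0) D k).2 /\
                m = mnm_add (nth (0%MM, set0) D k).1 w.

Definition sdepth_ge (K : fieldType) (n : nat) (G : seq 'X_{1..n}) (r : nat)
  : Prop :=
  exists D, stanley_decomp K G D /\ forall uZ, uZ \in D -> (r <= #|uZ.2|)%N.

(* Main.v *)
(* For v in G(I) let set(v) be the set of t such that x_t (v / x_j) lies in I for
   some j > t, and let q be the maximum of #|set(v)| over v in G(I).  Both
   depth(S/I) <= n - 1 - q and n - 1 - q <= sdepth(S/I) hold.

   Depth: ordering G(I) by degree, and lexicographically within a degree, gives
   linear quotients with colon ideals (x_t : t in set(v)).  A regular sequence of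
   length r in the maximal ideal kills the Koszul homology of S/I in degrees
   above n - r, whereas degree #|set(v)| + 1 has a nonzero class of multidegree
   v * prod_(t in set(v)) x_t: the generators preceding v have degree at most
   deg v, so their ideal has no homology at the relevant spot there, and the
   boundary of the simplex set(v) can be filled without set(v) itself.

   Stanley depth: slice S/I by the exponent d of x_1.  With D the largest exponent
   of x_1 in G(I), the slices d < D without a generator of exponent <= d are full
   polynomial rings, the others are smaller quotients by weakly polymatroidal
   ideals, for which x_1 leaves every set(v); the slices d >= D are all equal and
   get the free variable x_1 instead. *)
Require Import Defs.
From mathcomp Require Import all_boot all_order all_algebra.
From mathcomp Require Import mpoly.
From mathcomp Require Import ring zify.
Set Implicit Arguments. Unset Strict Implicit. Unset Printing Implicit Defensive.
Import Order.TTheory GRing.Theory.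
Local Open Scope ring_scope.

(** * The Koszul complex over a commutative ring *)

Section Koszul.
Variables (R : comNzRingType) (n : nat).
Implicit Types (A : {set 'I_n}) (s t : 'I_n) (x g : 'I_n -> R)
  (a b : {set 'I_n} -> R).

Definition ksign t A : R := (-1) ^+ #|[set u in A | (u < t)%N]|.

(** A chain is its family of coefficients on the basis e_A of the exterior algebra, all degrees at
    once; this is the coefficient of e_A in its Koszul differential. *)
Definition kdiff x a A : R := \sum_(t | t \notin A) ksign t A * x t * a (t |: A).

(** Left exterior multiplication by the sum of the g_t e_t. *)
Definition khomot g a A : R := \sum_(t in A) ksign t A * g t * a (A :\ t).

Lemma ksignU t s A : s \notin A ->
  ksign t (s |: A) = (-1) ^+ (s < t)%N * ksign t A.
Proof.
move=> sA; rewrite /ksign -exprD; congr (_ ^+ _).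
have -> : [set u in s |: A | (u < t)%N] =
    if (s < t)%N then s |: [set u in A | (u < t)%N] else [set u in A | (u < t)%N].
  apply/setP=> u; case: ifP => st; rewrite !inE; case: eqP => [->|] //=;
    by rewrite st ?(negbTE sA).
by case: ifP => st //; rewrite cardsU1 inE (negbTE sA).
Qed.

Lemma ksignD t s A : s \in A ->
  ksign t (A :\ s) = (-1) ^+ (s < t)%N * ksign t A.
Proof.
move=> sA; rewrite -{2}(setD1K sA) ksignU ?setD11 //.
by rewrite mulrA -exprD addnn -muln2 mulnC exprM sqrrN expr1n expr1n mul1r.
Qed.

Lemma ksign_sqr t A : ksign t A * ksign t A = 1.
Proof. by rewrite -expr2 -exprM mulnC exprM sqrrN expr1n expr1n. Qed.

Lemma kdiffB x a b A : kdiff x (fun B => a B - b B) A = kdiff x a A - kdiff x b A.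
Proof.
by rewrite -sumrB; apply: eq_bigr => t _; rewrite mulrBr.
Qed.

Lemma kdiffD x a b A : kdiff x (fun B => a B + b B) A = kdiff x a A + kdiff x b A.
Proof.
by rewrite -big_split; apply: eq_bigr => t _; rewrite mulrDr.
Qed.

Lemma kdiffZ x c a A : kdiff x (fun B => c * a B) A = c * kdiff x a A.
Proof. by rewrite mulr_sumr; apply: eq_bigr => t _; rewrite mulrCA. Qed.

Lemma khomot0 g a A : (forall t, t \in A -> a (A :\ t) = 0) -> khomot g a A = 0.
Proof. by move=> a0; apply: big1 => t tA; rewrite a0 ?mulr0. Qed.

Lemma kdiffK x a A : kdiff x (kdiff x a) A = 0.
Proof.
pose F t s := ksign t A * x t * (ksign s (t |: A) * x s * a (s |: (t |: A))).
have -> : kdiff x (kdiff x a) A =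
   \sum_(t | t \notin A) \sum_(s | s \notin t |: A) F t s.
  by apply: eq_bigr => t _; rewrite mulr_sumr.
rewrite pair_big_dep /= (bigID (fun p : 'I_n * 'I_n => (p.1 < p.2)%N)) /=.
rewrite [X in _ + X](reindex_inj (h := fun p : 'I_n * 'I_n => (p.2, p.1))) /=; last first.
  by move=> [p1 p2] [q1 q2] [-> ->].
rewrite [X in _ + X](eq_bigl (fun p : 'I_n * 'I_n =>
    (p.1 \notin A) && (p.2 \notin p.1 |: A) && (p.1 < p.2)%N)); last first.
  move=> [t s] /=; rewrite !inE !negb_or -!val_eqE /=.
  by case: (t \in A); case: (s \in A); case: ltngtP.
rewrite -big_split big1 //= => -[t s] /=; rewrite !inE negb_or.
case/andP=> /andP[tA /andP[st sA]] lts.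
rewrite /F !ksignU // lts ltnNge (ltnW lts) /= expr0 expr1 setUCA.
ring.
Qed.

(** Terms moving two distinct indices cancel by sign; only the diagonal ones remain. So any
    combination of the [x t] acts null-homotopically on the Koszul complex. *)
Lemma kdiff_khomot x g a A :
  kdiff x (khomot g a) A + khomot g (kdiff x a) A = (\sum_t x t * g t) * a A.
Proof.
rewrite /kdiff {1}/khomot.
under eq_bigr => t tA do rewrite big_setU1 //= setU1K // ksignU // ltnn expr0 mul1r
  mulrDr.
rewrite big_split /= /khomot.
under [X in _ + X]eq_bigr => s sA.
  rewrite (bigD1 s) /=; last by rewrite setD11.
  rewrite setD1K // ksignD // ltnn expr0 mul1r mulrDr.
  rewrite (eq_bigl (fun t => t \notin A)); last first.
    by move=> t; rewrite !inE; case: eqP => [->|_] /=; rewrite ?sA ?andbF ?andbT.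
  over.
rewrite big_split /= mulr_suml.
rewrite [RHS](bigID (fun t => t \notin A)) /=.
have e1 : \sum_(i | i \notin A) ksign i A * x i * (ksign i A * g i * a A)
  = \sum_(i | i \notin A) x i * g i * a A.
  by apply: eq_bigr => t _; move: (ksign_sqr t A) => e; ring: e.
have e2 : \sum_(i in A) ksign i A * g i * (ksign i A * x i * a A)
  = \sum_(i | ~~ (i \notin A)) x i * g i * a A.
  rewrite (eq_bigl (fun i => ~~ (i \notin A))); last by move=> i; rewrite negbK.
  by apply: eq_bigr => t _; move: (ksign_sqr t A) => e; ring: e.
rewrite e1 e2 -!addrA; congr (_ + _); rewrite addrCA -[RHS]addr0; congr (_ + _).
under eq_bigr do rewrite mulr_sumr.
under [X in _ + X]eq_bigr do rewrite mulr_sumr.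
rewrite [X in _ + X]exchange_big /= -big_split big1 //= => t tA.
rewrite -big_split big1 //= => s sA.
have ts : t != s by apply: contraNneq tA => ->.
rewrite ksignU // ksignD //.
have -> : (t |: A) :\ s = t |: (A :\ s).
  by apply/setP=> u; rewrite !inE; case: (u =P t) => [->|_] //=; rewrite ts.
have [lts|lst|/val_inj e] := ltngtP t s; last by rewrite e eqxx in ts.
  rewrite expr0 expr1; ring.
rewrite expr0 expr1; ring.
Qed.

End Koszul.

(** * Ideal membership, and vanishing of Koszul homology along regular sequences *)

Section Ideals.
Variables (K : fieldType) (n : nat).
Implicit Types (gs fs : seq {mpoly K[n]}) (f p q : {mpoly K[n]}) (G : seq 'X_{1..n}).

Lemma in_idealP gs p :
  in_ideal gs p <-> exists c : nat -> {mpoly K[n]},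
    p = \sum_(i < size gs) c i * gs`_i.
Proof.
split=> [[cs [_ ->]]|[c ->]]; first by exists (fun i => cs`_i).
exists (mkseq c (size gs)); rewrite size_mkseq; split=> //.
by apply: eq_bigr => i _; rewrite nth_mkseq.
Qed.

Lemma in_ideal0 gs : in_ideal gs 0.
Proof. by apply/in_idealP; exists (fun=> 0); rewrite big1 // => i _; rewrite mul0r. Qed.

Lemma in_idealD gs p q : in_ideal gs p -> in_ideal gs q -> in_ideal gs (p + q).
Proof.
move=> /in_idealP[c ->] /in_idealP[d ->]; apply/in_idealP.
by exists (fun i => c i + d i); rewrite -big_split; apply: eq_bigr => i _; rewrite mulrDl.
Qed.

Lemma in_idealM gs p q : in_ideal gs q -> in_ideal gs (p * q).
Proof.
move=> /in_idealP[c ->]; apply/in_idealP; exists (fun i => p * c i).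
by rewrite mulr_sumr; apply: eq_bigr => i _; rewrite mulrA.
Qed.

Lemma in_ideal_sum gs (I : Type) (r : seq I) (P : pred I) (F : I -> {mpoly K[n]}) :
  (forall i, P i -> in_ideal gs (F i)) -> in_ideal gs (\sum_(i <- r | P i) F i).
Proof.
by move=> IF; apply: big_ind => //; [exact: in_ideal0 | exact: in_idealD].
Qed.

Lemma in_ideal_rcons gs f p :
  in_ideal (rcons gs f) p <-> exists c, in_ideal gs (p - f * c).
Proof.
split=> [/in_idealP[c ->]|[c /in_idealP[d e]]].
  exists (c (size gs)); apply/in_idealP; exists c.
  rewrite size_rcons big_ord_recr /= nth_rcons ltnn eqxx [f * _]mulrC addrK.
  by apply: eq_bigr => i _; rewrite nth_rcons ltn_ord.
apply/in_idealP; exists (fun i => if (i < size gs)%N then d i else c).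
rewrite size_rcons big_ord_recr /= nth_rcons ltnn eqxx.
rewrite (eq_bigr (fun i : 'I_(size gs) => d i * gs`_i)) -?e; first by ring.
by move=> i _; rewrite nth_rcons ltn_ord.
Qed.

(* The Koszul homology of S/(gs) vanishes in degree p. *)
Definition koszul_exact gs (p : nat) := forall a : {set 'I_n} -> {mpoly K[n]},
  (forall A : {set 'I_n}, #|A|.+1 = p -> in_ideal gs (kdiff (fun t => 'X_t) a A)) ->
  exists b, forall A : {set 'I_n}, #|A| = p -> in_ideal gs (a A - kdiff (fun t => 'X_t) b A).

Lemma zero_const_comb f : f@_(0%MM) = 0 ->
  exists g : 'I_n -> {mpoly K[n]}, f = \sum_t 'X_t * g t.
Proof.
move=> f0; rewrite [f]mpolyE big_seq.
apply: (big_ind (fun f => exists g : 'I_n -> {mpoly K[n]}, f = \sum_t 'X_t * g t)).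
- by exists (fun=> 0); rewrite big1 // => t _; rewrite mulr0.
- move=> _ _ [g ->] [h ->]; exists (fun t => g t + h t).
  by rewrite -big_split; apply: eq_bigr => t _; rewrite mulrDr.
move=> m; rewrite mcoeff_msupp => fm.
have [t mt]: exists t, (U_(t) <= m)%MM.
  have m0 : m != 0%MM by apply: contraNneq fm => ->; rewrite f0.
  rewrite -mdeg_eq0 mdegE sum_nat_eq0 negb_forall in m0.
  by have /existsP[t /= mt] := m0; exists t; rewrite lep1mP.
exists (fun s => if s == t then f@_m *: 'X_[m - U_(t)] else 0).
rewrite (bigD1 t) //= eqxx big1 ?addr0 => [|s /negbTE->]; last by rewrite mulr0.
by rewrite -scalerAr -mpolyXD addmC submK.
Qed.

(** Induction on [fs]. Write f as the sum of the x_t g_t and let h be the homotopy for g. For a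
    cycle a modulo [gs], f a = d (h a), so h a is a cycle modulo [gs] and f, one degree higher. By
    induction h a = d c + f e; applying d gives f a = f (d e) modulo [gs], and f cancels. *)
Lemma regular_koszul_exact gs fs (p : nat) :
  regular_aux gs fs -> (n < p + size fs)%N -> koszul_exact gs p.
Proof.
elim: fs gs p => [|f fs IH] gs p /=.
  move=> _ np a _; exists (fun=> 0) => A Ap.
  by have := max_card (mem A); rewrite card_ord Ap; move: np; lia.
case=> f0 [nzd reg] np a cyc.
have [g fE] := zero_const_comb f0.
pose d := @kdiff _ n (fun t => 'X_t : {mpoly K[n]}).
have fa A : f * a A = d (khomot g a) A + khomot g (d a) A.
  by rewrite /d kdiff_khomot -fE.
have hda (A : {set 'I_n}) : #|A| = p -> in_ideal gs (khomot g (d a) A).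
  move=> Ap; apply: in_ideal_sum => t tA; apply: in_idealM; apply: cyc.
  by rewrite -Ap [in RHS](cardsD1 t) tA.
have lt : (n < p.+1 + size fs)%N by move: np; lia.
have [|c hc] := IH _ p.+1 reg lt (khomot g a).
  move=> A [Ap]; apply/in_ideal_rcons; exists (a A).
  by rewrite fa -/(d _) opprD addNKr -mulN1r; apply: in_idealM; apply: hda.
have /fin_all_exists[e he] : forall A : {set 'I_n}, exists e, #|A| = p.+1 ->
    in_ideal gs (khomot g a A - d c A - f * e).
  move=> A; case: (#|A| =P p.+1) => [Ap|nAp]; last by exists 0.
  by have /in_ideal_rcons[e he] := hc A Ap; exists e.
exists e => A Ap; apply: nzd.
have -> : f * (a A - d e A) =
    d (fun B => khomot g a B - d c B - f * e B) A + khomot g (d a) A.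
  rewrite mulrBr fa /d (kdiffB _ (fun B => khomot g a B - d c B)) kdiffB kdiffZ kdiffK.
  by rewrite /d; ring.
apply: in_idealD; last exact: hda.
apply: in_ideal_sum => t tA; apply: in_idealM; apply: he.
by rewrite cardsU1 tA Ap.
Qed.

Definition divides G (m : 'X_{1..n}) := has (fun g => (g <= m)%MM) G.

Lemma dividesP G m : reflect (exists2 g, g \in G & (g <= m)%MM) (divides G m).
Proof. exact: hasP. Qed.

Lemma divides_lem G m m' : divides G m -> (m <= m')%MM -> divides G m'.
Proof.
by move=> /dividesP[g gG gm] mm'; apply/dividesP; exists g => //; apply: lepm_trans mm'.
Qed.

Lemma in_mon_ideal_coef G p m :
  in_ideal (mon_gens K G) p -> p@_m != 0 -> divides G m.
Proof.
move=> /in_idealP[c ->]; apply: contraR => ndiv.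
rewrite raddf_sum big1 //= => i _.
have iG : (i < size G)%N by rewrite -(size_map (fun g => 'X_[g] : {mpoly K[n]})).
rewrite (nth_map 0%MM) //; apply/eqP; rewrite mcoeff_eq0.
rewrite (perm_mem (msuppMX _ _)); apply: contra ndiv => /mapP[m' _ ->].
apply/dividesP; exists (nth 0%MM G i); first exact: mem_nth.
exact: lem_addr.
Qed.

Lemma mon_ideal_gen G p g : g \in G -> in_ideal (mon_gens K G) (p * 'X_[g]).
Proof.
move=> gG; apply/in_idealP; exists (fun i => if i == index g G then p else 0).
have ig : (index g G < size (mon_gens K G))%N by rewrite size_map index_mem.
rewrite (bigD1 (Ordinal ig)) //= eqxx big1 ?addr0.
  by rewrite (nth_map 0%MM) ?index_mem // nth_index.
by move=> i; rewrite -val_eqE /= => /negbTE ->; rewrite mul0r.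
Qed.

Lemma divides_in_ideal G m c :
  divides G m -> in_ideal (mon_gens K G) (c * 'X_[m]).
Proof.
move=> /dividesP[g gG gm]; rewrite -(submK gm) mpolyXD mulrA.
exact: mon_ideal_gen.
Qed.

Lemma mon_inP G m : mon_in K G m <-> divides G m.
Proof.
split=> [Gm|Gm]; first by apply: (in_mon_ideal_coef Gm); rewrite mcoeffX eqxx oner_neq0.
by rewrite /mon_in -[X in in_ideal _ X]mul1r; apply: divides_in_ideal.
Qed.

(** Otherwise Koszul homology would vanish even in degree 0, placing 1 in the sum of I and the ideal
    of the variables. This bound serves the zero ideal. *)
Lemma depth_ge_le G r : ~ mon_in K G 0%MM -> depth_ge K G r -> (r <= n)%N.
Proof.
move=> nI [fs [<- [reg _]]]; rewrite leqNgt; apply/negP => nr.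
have ex : koszul_exact (mon_gens K G) 0.
  exact: (@regular_koszul_exact _ _ 0 reg nr).
have [|b /(_ set0)] := ex (fun=> 1); first by [].
rewrite cards0 => /(_ erefl) I1.
apply/nI/mon_inP/(in_mon_ideal_coef I1).
rewrite mcoeffB mcoeff1 eqxx raddf_sum big1 ?subr0 ?oner_neq0 //= => t _.
by rewrite !rmorphM /= mcoeffX mnm1_eq0 mulr0 mul0r.
Qed.

End Ideals.

(** * The exchange property and linear quotients *)

Section Exchange.
Variables (n : nat) (G : seq 'X_{1..n}).
Implicit Types (u v w m : 'X_{1..n}) (s t j : 'I_n).

Definition agree_below (i : nat) u v := forall s, (s < i)%N -> u s = v s.

Definition exchangeable v t :=
  [exists j : 'I_n, [&& (t < j)%N, (0 < v j)%N & divides G (v - U_(j) + U_(t))%MM]].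

(** These variables generate the colon by v of the ideal of the generators preceding v; see
    [linear_quotients]. *)
Definition exchange_set v := [set t | exchangeable v t].

Hypothesis minG : forall u v, u \in G -> v \in G -> (u <= v)%MM -> u = v.
Hypothesis wpG : forall u v t, u \in G -> v \in G -> agree_below t u v ->
  (v t < u t)%N -> exchangeable v t.

(** If u did not use the extra x_t it would divide w, hence equal w by minimality, although its
    exponent at j is smaller. *)
Lemma exchange_bounds u w t j : u \in G -> w \in G -> t != j -> (0 < w j)%N ->
  (u <= w - U_(j) + U_(t))%MM ->
  [/\ u t = (w t).+1, forall s, s != t -> (u s <= w s)%N & (mdeg u <= mdeg w)%N].
Proof.
move=> uG wG tj wj /mnm_lepP le.
have le_s s : s != t -> (u s <= w s)%N.
  by move=> st; have := le s; rewrite mnmDE mnmBE !mnm1E [t == s]eq_sym (negbTE st); lia.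
split=> //.
  have := le t; rewrite mnmDE mnmBE !mnm1E eqxx eq_sym (negbTE tj) => ltt.
  have [ut|] := leqP (u t) (w t); last by lia.
  have uw : u = w.
    apply: minG => //; apply/mnm_lepP => s; case: (s =P t) => [->//|/eqP].
    exact: le_s.
  have := le j; rewrite uw mnmDE mnmBE !mnm1E eqxx (negbTE tj); lia.
have e : mdeg (w - U_(j) + U_(t))%MM = mdeg w.
  rewrite mdegD mdeg1 -(mdeg1 j) -mdegD submK //.
  by rewrite lep1mP -lt0n.
by rewrite -e !mdegE; apply: leq_sum => s _.
Qed.

(** Induction on i. If a generator w dividing m falls short of v at the next variable t, exchanging
    against v puts w x_t / x_j in I with the same prefix, since j > t; a generator below it has
    exponent exactly one more at t and still divides m. *)
Lemma prefix_gen v m (i : nat) : v \in G -> divides G m -> agree_below i m v ->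
  exists w, [/\ w \in G, (w <= m)%MM & agree_below i w v].
Proof.
move=> vG; elim: i m => [|i IH] m Gm mv.
  by have /dividesP[w wG wm] := Gm; exists w; split.
have [ni|lin] := leqP n i.
  have [|w [wG wm wv]] := IH m Gm; first by move=> s si; apply: mv; lia.
  by exists w; split=> // s si; apply: wv; have := ltn_ord s; lia.
pose t := Ordinal lin.
have [|w [wG /mnm_lepP wm wv]] := IH m Gm; first by move=> s si; apply: mv; lia.
have mt : m t = v t by apply: mv => /=.
have [k] := ubnP (v t - w t); elim: k w wG wm wv => // k IHk w wG wm wv le_k.
have := wm t; rewrite mt leq_eqVlt => /orP[/eqP wt|wt].
  exists w; split=> //; first exact/mnm_lepP.
  move=> s; rewrite ltnS leq_eqVlt => /orP[/eqP si|]; last exact: wv.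
  by have -> : s = t by apply: val_inj.
have /existsP[j /and3P[tj wj Gm']] : exchangeable w t.
  by apply: (wpG vG wG) wt => s si; rewrite wv.
have tNj : t != j by rewrite -val_eqE neq_ltn tj.
have [|w' [w'G w'm' w'v]] := IH _ Gm'.
  move=> s si; rewrite mnmDE mnmBE !mnm1E -wv //.
  have /negbTE -> : j != s by rewrite -val_eqE /=; move: tj => /=; lia.
  by have /negbTE -> : t != s; [rewrite -val_eqE /=; lia | lia].
have [w't w's _] := exchange_bounds w'G wG tNj wj w'm'.
apply: (IHk w') => //; last by rewrite w't; lia.
move=> s; case: (s =P t) => [->|/eqP st]; first by rewrite w't mt.
exact: leq_trans (w's _ st) (wm s).
Qed.

(** This turns membership in the exchange set into a generator u that precedes w and divides w
    x_t. *)
Lemma exchange_gen w t : w \in G -> t \in exchange_set w -> exists u,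
  [/\ u \in G, agree_below t u w, u t = (w t).+1,
      forall s, s != t -> (u s <= w s)%N & (mdeg u <= mdeg w)%N].
Proof.
move=> wG; rewrite inE => /existsP[j /and3P[tj wj Gm]].
have tNj : t != j by rewrite -val_eqE neq_ltn tj.
have [|u [uG um uw]] := prefix_gen (i := t) wG Gm.
  move=> s si; rewrite mnmDE mnmBE !mnm1E.
  have /negbTE -> : j != s by rewrite -val_eqE /=; lia.
  by have /negbTE -> : t != s; [rewrite -val_eqE /=; lia | lia].
by have [ut us du] := exchange_bounds uG wG tNj wj um; exists u.
Qed.

(* Smaller degree first, lexicographically larger first within a degree. *)
Definition gen_le u v := (mdeg u < mdeg v)%N || (mdeg u == mdeg v) && (v <= u)%O.

Lemma gen_le_total : total gen_le.
Proof.
by move=> u v; rewrite /gen_le; case: ltngtP => //= _; apply: le_total.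
Qed.

Lemma gen_le_trans : transitive gen_le.
Proof.
move=> v u w; rewrite /gen_le => /orP[uv|/andP[/eqP uv lvu]] /orP[vw|/andP[/eqP vw lwv]].
- by rewrite (ltn_trans uv vw).
- by rewrite -vw uv.
- by rewrite uv vw.
- by rewrite uv vw eqxx (le_trans lwv lvu) orbT.
Qed.

Lemma gen_le_mdeg u v : gen_le u v -> (mdeg u <= mdeg v)%N.
Proof. by case/orP => [/ltnW//|/andP[/eqP -> _]]. Qed.

(** In equal degree, the first place where u and v differ works. In smaller degree, u is deformed
    towards v one variable at a time. *)
Lemma earlier_gen_exchange u v : u \in G -> v \in G -> u != v -> gen_le u v ->
  exists2 s, s \in exchange_set v & (v s < u s)%N.
Proof.
move=> uG vG uNv /orP[lt|/andP[/eqP e lvu]]; last first.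
  have {}lvu : (v < u)%O by rewrite lt_neqAle eq_sym uNv.
  have /ltmcP := lvu => /(_ (esym e))[t vu ltt].
  exists t; rewrite ?inE //; apply: (wpG uG vG) => // s st.
  by rewrite vu.
(* The deformed generator w keeps degree below v and exceeds v only where u does. Agreement in all n
   variables would force w = v, against the degrees. *)
suff /(_ n)[//|[w [_ ltw _ wv]]] : forall i : nat,
    (exists2 s, s \in exchange_set v & (v s < u s)%N) \/
    exists w, [/\ w \in G, (mdeg w < mdeg v)%N,
       forall s, (v s < w s)%N -> (v s < u s)%N & agree_below i w v].
  have e : w = v by apply/mnmP => s; apply: wv.
  by rewrite e ltnn in ltw.
elim=> [|i [IH|[w [wG ltw wu wv]]]]; [by right; exists u | by left |].
have [ni|lin] := leqP n i.
  right; exists w; split=> // s si; apply: wv; have := ltn_ord s; lia.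
pose t := Ordinal lin.
have [k] := ubnP (v t - w t); elim: k w wG ltw wu wv => // k IHk w wG ltw wu wv le_k.
(* A deficit at t is repaired by an exchange in w; an excess puts t in the exchange set of v and
   ends the search. *)
have [wt|vt|wt] := ltngtP (w t) (v t).
- have tw : t \in exchange_set w.
    by rewrite inE; apply: (wpG vG wG) wt => s si; rewrite wv.
  have [w' [w'G w'w w't w's dw']] := exchange_gen wG tw.
  apply: (IHk w') => //; [exact: leq_ltn_trans ltw | | | by rewrite w't; lia].
    move=> s; case: (s =P t) => [->|/eqP st]; first by rewrite w't; lia.
    by move=> h; apply: wu; apply: leq_trans (w's _ st).
  by move=> s si; rewrite w'w ?wv.
- left; exists t; last exact: wu.
  by rewrite inE; apply: (wpG wG vG).
- right; exists w; split=> // s; rewrite ltnS leq_eqVlt => /orP[/eqP si|]; last exact: wv.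
  by have -> : s = t by apply: val_inj.
Qed.

Lemma linear_quotients v m : v \in G ->
  (exists u, [/\ u \in G, u != v, gen_le u v & (u <= v + m)%MM]) <->
  exists2 t, t \in exchange_set v & (0 < m t)%N.
Proof.
move=> vG; split=> [[u [uG uv ruv /mnm_lepP le]]|[t tv mt]].
  have [s sv lts] := earlier_gen_exchange uG vG uv ruv.
  by exists s => //; have := le s; rewrite mnmDE; lia.
have [u [uG uv ut us du]] := exchange_gen vG tv; exists u; split=> //.
- by apply: contra_eq_neq ut => ->; rewrite neq_ltn ltnSn.
- rewrite /gen_le; case: ltngtP du => //= e _; apply: ltW; apply/ltmcP => //.
  by exists t => [s st|]; [rewrite uv | rewrite ut].
apply/mnm_lepP => s; rewrite mnmDE; case: (s =P t) => [->|/eqP /us]; lia.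
Qed.

End Exchange.

(** * Koszul simplicial complexes of monomial ideals *)

Section KoszulComplex.
Variables (K : fieldType) (n : nat).
Implicit Types (L : seq 'X_{1..n}) (b v w m : 'X_{1..n}) (A B T : {set 'I_n}).
Implicit Types (s t : 'I_n) (z y : {set 'I_n} -> K).

Definition mset A : 'X_{1..n} := [multinom (i \in A : nat) | i < n].

Lemma msetE A i : mset A i = (i \in A). Proof. exact: mnmE. Qed.

Lemma mdeg_mset A : mdeg (mset A) = #|A|.
Proof.
by rewrite mdegE -sum1_card [RHS]big_mkcond; apply: eq_bigr => i _; rewrite msetE; case: ifP.
Qed.

Lemma msetU t A : t \notin A -> mset (t |: A) = (U_(t) + mset A)%MM.
Proof.
move=> tA; apply/mnmP => s; rewrite mnmDE mnm1E !msetE in_setU1 eq_sym.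
by case: (t =P s) => [<-|_] //; rewrite (negbTE tA).
Qed.

(** The upper Koszul simplicial complex at b of the ideal generated by L. The first conjunct guards
    against truncated subtraction. *)
Definition face L b A := (mset A <= b)%MM && divides L (b - mset A).

Lemma faceU L b t A : t \notin A -> face L b (t |: A) -> face L b A.
Proof.
move=> tA; rewrite /face msetU // => /andP[le div]; apply/andP; split.
  by apply: lepm_trans le; apply: lem_addl.
by apply: divides_lem div _; rewrite addmC -submDA lem_subr.
Qed.

Lemma face_rcons L w b A : face L b A -> face (rcons L w) b A.
Proof. by case/andP=> le d; rewrite /face le /divides has_rcons [has _ _]d orbT. Qed.

(** Linear quotients in the given order: each colon ideal is generated by the variables in some T,
    and generators have degree at most e. *)
Definition lq_list (e : nat) L := forall L1 w L2, L = L1 ++ w :: L2 ->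
  (mdeg w <= e)%N /\ exists T : {set 'I_n}, forall m,
    divides L1 (w + m) <-> exists2 t, t \in T & (0 < m t)%N.

Lemma lq_list_belast e L w : lq_list e (rcons L w) -> lq_list e L.
Proof.
by move=> lq L1 u L2 E; apply: (lq L1 u (rcons L2 w)); rewrite E rcons_cat.
Qed.

(** The augmented simplicial boundary over K; below it, the cone with apex t. *)
Let bd := @kdiff K n (fun=> 1).
Let cone t := @khomot K n (fun s => (s == t)%:R).

Lemma bd_cone t z A : bd (cone t z) A + cone t (bd z) A = z A.
Proof.
rewrite /bd /cone kdiff_khomot (bigD1 t) //= eqxx big1 ?addr0 ?mul1r // => s /negbTE ->.
by rewrite mulr0.
Qed.

Lemma bd_neq0 z A : bd z A != 0 -> exists2 t, t \notin A & z (t |: A) != 0.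
Proof.
move=> nz; apply/exists_inP; apply: contraNT nz => /exists_inPn z0.
by apply/eqP/big1 => t tA; have := z0 t tA; rewrite negbK => /eqP ->; rewrite mulr0.
Qed.

Lemma cone_neq0 t z A : cone t z A != 0 -> t \in A /\ z (A :\ t) != 0.
Proof.
move=> nz; suff: (t \in A) && (z (A :\ t) != 0) by case/andP.
apply: contraNT nz => tz; apply/eqP/big1 => s sA.
case: (s =P t) => [e|_]; last by rewrite mulr0 mul0r.
by subst s; move: tz; rewrite sA negbK => /eqP ->; rewrite mulr0.
Qed.

(** With linear quotients and generators of degree at most e, homology at faces of size q - 1 lives
    only in multidegrees of degree at most e + q - 1. Induction on L: the faces gained with the last
    generator w either form a relative cone or cannot have size q - 1. *)
Lemma koszul_complex_acyclic L b (e q : nat) z :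
  lq_list e L -> (e + q <= mdeg b)%N ->
  (forall A, z A != 0 -> #|A|.+1 = q /\ face L b A) ->
  (forall A, bd z A = 0) ->
  exists y, (forall A, y A != 0 -> #|A| = q /\ face L b A) /\
            (forall A, z A = bd y A).
Proof.
elim/last_ind: L z => [|L w IH] z lq le_b suppz cyc.
  exists (fun=> 0); split=> [A|A]; first by rewrite eqxx.
  rewrite [bd _ _]big1 => [|t _]; last by rewrite mulr0.
  by apply/eqP/negPn/negP => /suppz[_ /andP[_]].
have {}IH := IH _ (lq_list_belast lq) le_b.
have [|we [T lqw]] := lq L w [::]; first by rewrite cats1.
pose c := (b - w)%MM.
pose new A := face (rcons L w) b A && ~~ face L b A.
have newP A : new A -> [/\ (w <= b)%MM, (mset A <= c)%MM &
    forall t, t \in T -> c t = (t \in A)].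
  case/andP=> /andP[Ab]; rewrite /face Ab /divides has_rcons /= => /orP[wbA ndiv|/[swap]/negP//].
  have wb : (w <= b)%MM by apply: lepm_trans wbA _; apply: lem_subr.
  have Ac : (mset A <= c)%MM.
    apply/mnm_lepP => i; move/mnm_lepP/(_ i): wbA; move/mnm_lepP/(_ i): Ab.
    by rewrite /c !mnmBE; lia.
  split=> // t tT; move/mnm_lepP/(_ t): (Ac); rewrite msetE leq_eqVlt => /orP[/eqP->//|lt].
  case/negP: ndiv.
  have -> : (b - mset A = w + (c - mset A))%MM.
    apply/mnmP => i; move/mnm_lepP/(_ i): wbA; move/mnm_lepP/(_ i): Ab.
    by rewrite mnmDE !mnmBE; lia.
  by apply/lqw; exists t => //; rewrite mnmBE msetE subn_gt0.
(* A variable t0 outside T dividing b / w is an apex for the new faces. Without one, a new face A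
   satisfies b = w + A, so the degree of b is at most e + q - 1. *)
have [/exists_inP[t0 t0T ct0]|/exists_inPn noT] :=
    boolP [exists t in [set s | s \notin T], (0 < c t)%N]; last first.
  have old A : z A != 0 -> #|A|.+1 = q /\ face L b A.
    move=> zA; have [Aq fA] := suppz A zA; split=> //; apply: contraT => nf.
    have [|wb Ac cA] := newP A; first by rewrite /new fA.
    have cE : c = mset A.
      apply/mnmP => t; rewrite [RHS]msetE; have [tT|tT] := boolP (t \in T); first exact: cA.
      have := noT t; rewrite inE tT -leqNgt leqn0 => /(_ isT)/eqP ct.
      by move/mnm_lepP/(_ t): Ac; rewrite ct msetE; lia.
    have := mdegD c w; rewrite {1}/c submK // cE mdeg_mset; lia.
  have [y [suppy zy]] := IH _ old cyc; exists y; split=> // A /suppy[-> fA].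
  by split=> //; apply: face_rcons.
rewrite inE in t0T.
pose zn A := if new A then z A else 0.
have zn_new A : zn A != 0 -> z A != 0 /\ new A.
  by rewrite /zn; case: ifP => // _; rewrite eqxx.
have zo_old A : z A - zn A != 0 -> #|A|.+1 = q /\ face L b A.
  rewrite /zn; case: ifP => [|/negbT nA]; first by rewrite subrr eqxx.
  rewrite subr0 => zA; have [Aq fA] := suppz A zA; split=> //.
  by move: nA; rewrite /new fA negbK.
have addt0 A : t0 \in A -> (mset (A :\ t0) <= c)%MM -> (mset A <= c)%MM.
  move=> t0A /mnm_lepP le; apply/mnm_lepP => i; have := le i; rewrite !msetE !inE.
  by case: (i =P t0) => [->|_] //=; rewrite t0A.
pose y1 := cone t0 zn.
have suppy1 A : y1 A != 0 -> #|A| = q /\ face (rcons L w) b A.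
  case/cone_neq0=> t0A /zn_new[zA /newP[/mnm_lepP wb Ac _]].
  have [<- _] := suppz _ zA; rewrite (cardsD1 t0 A) t0A; split=> //.
  have /mnm_lepP {}Ac := addt0 _ t0A Ac.
  rewrite /face /divides has_rcons; apply/andP; split; last (apply/orP; left).
    by apply/mnm_lepP => i; apply: leq_trans (Ac i) _; rewrite mnmBE leq_subr.
  by apply/mnm_lepP => i; have := Ac i; have := wb i; rewrite !mnmBE; lia.
have bdzn A : bd zn A = - bd (fun B => z B - zn B) A.
  by rewrite /bd kdiffB -/bd cyc sub0r opprK.
(* What is left is the old part of z plus the cone over the boundary of its new part. That boundary
   is old because z is a cycle, and coning with t0 keeps it old because t0 is not in T. *)
have old' A : z A - bd y1 A != 0 -> #|A|.+1 = q /\ face L b A.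
  have -> : z A - bd y1 A = (z A - zn A) + cone t0 (bd zn) A.
    by rewrite -{1}[zn A](bd_cone t0) /y1; ring.
  have [->|/zo_old//] := eqVneq (z A - zn A) 0.
  rewrite add0r => /cone_neq0[t0A]; set B := A :\ t0 => nz.
  have t0B : t0 \notin B by rewrite setD11.
  have AE : A = t0 |: B by rewrite setD1K.
  have [s sB /zo_old[sq fs]] : exists2 s, s \notin B & z (s |: B) - zn (s |: B) != 0.
    by apply: (@bd_neq0 (fun B => z B - zn B)); rewrite -oppr_eq0 -bdzn.
  have [s' s'B /zn_new[_ /newP[/mnm_lepP wb s'Bc _]]] := bd_neq0 nz.
  have Bc : (mset B <= c)%MM.
    by apply: lepm_trans s'Bc; rewrite msetU // lem_addl.
  have /mnm_lepP Ac := addt0 _ t0A Bc; move/mnm_lepP in Bc.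
  split; first by rewrite -sq AE !cardsU1 t0B sB.
  have /andP[_ dB] := faceU sB fs.
  have BE : (b - mset B = w + (c - mset B))%MM.
    by apply/mnmP => i; rewrite mnmDE; have := Bc i; have := wb i; rewrite !mnmBE; lia.
  rewrite BE in dB; have /lqw[t tT ht] := dB.
  apply/andP; split.
    by apply/mnm_lepP => i; apply: leq_trans (Ac i) _; rewrite mnmBE leq_subr.
  have -> : (b - mset A = w + (c - mset A))%MM.
    by apply/mnmP => i; rewrite mnmDE; have := Ac i; have := wb i; rewrite !mnmBE; lia.
  apply/lqw; exists t => //; rewrite mnmBE in ht.
  rewrite AE msetU // mnmBE mnmDE mnm1E.
  by have /negbTE -> : t0 != t by apply: contraNneq t0T => ->.
have [|y2 [suppy2 zy2]] := IH _ old'.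
  by move=> A; rewrite /bd kdiffB kdiffK subr0 -/bd.
exists (fun A => y1 A + y2 A); split=> A.
  have [->|/suppy1//] := eqVneq (y1 A) 0.
  by rewrite add0r => /suppy2[-> fA]; split=> //; apply: face_rcons.
by rewrite /bd kdiffD -/bd -zy2 addrC subrK.
Qed.

Lemma ksign_scale t A (p : {mpoly K[n]}) : ksign _ t A * p = ksign K t A *: p.
Proof. by rewrite /ksign -signr_odd mulr_sign -[in RHS]signr_odd scaler_sign. Qed.

(** A minimal generator never occurs in a product of x_t with an element of I. *)
Lemma min_gen_coef G v t (p : {mpoly K[n]}) : v \in G ->
  (forall u, u \in G -> (u <= v)%MM -> u = v) ->
  in_ideal (mon_gens K G) p -> (p * 'X_t)@_v = 0.
Proof.
move=> vG minv Ip; apply/eqP; rewrite mcoeff_eq0 (perm_mem (msuppMX _ _)).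
apply/mapP => -[m]; rewrite mcoeff_msupp => pm vE.
have /dividesP[u uG um] := in_mon_ideal_coef Ip pm.
have uv : u = v by apply: minv => //; rewrite vE; apply: lepm_trans um (lem_addl _ _).
move/mnm_lepP/(_ t): um; rewrite uv vE mnmDE mnm1E eqxx; lia.
Qed.

(* A Koszul cycle of I at b, with coefficient 1 at a facet T of its Koszul
   complex for which b - T is the minimal generator v, is a nonzero class. *)
Lemma koszul_nonexact G b v T z : v \in G -> v != 0%MM ->
  (forall u, u \in G -> (u <= v)%MM -> u = v) ->
  b = (v + mset T)%MM ->
  (forall A, z A != 0 -> #|A| = #|T| /\ face G b A) ->
  (forall A, bd z A = 0) -> z T = 1 ->
  ~ koszul_exact (mon_gens K G) #|T|.+1.
Proof.
move=> vG v0 minv bE suppz cyc zT ex.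
have [t0 bt0] : exists t, (0 < b t)%N.
  rewrite -mdeg_eq0 mdegE sum_nat_eq0 negb_forall in v0.
  by have /existsP[t /= vt] := v0; exists t; rewrite bE mnmDE; lia.
(* The cone fills z among the squarefree divisors of b, but possibly outside the complex. Its
   homogenization [a] has differential with coefficients in I, so it is a cycle of S/I. *)
pose l := cone t0 z.
have bdl A : bd l A = z A.
  by rewrite -[RHS](bd_cone t0) [X in _ + X]khomot0 ?addr0 // => t _; apply: cyc.
have suppl A : l A != 0 -> (mset A <= b)%MM.
  case/cone_neq0=> t0A /suppz[_ /andP[/mnm_lepP le _]]; apply/mnm_lepP => i.
  by have := le i; rewrite !msetE !inE; case: (i =P t0) => [->|_] //=; rewrite t0A.
pose a A : {mpoly K[n]} := l A *: 'X_[b - mset A].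
have bda A : kdiff (fun t => 'X_t) a A = z A *: 'X_[b - mset A].
  rewrite -bdl /bd /kdiff scaler_suml; apply: eq_bigr => t tA.
  rewrite -mulrA ksign_scale mulr1 -scalerA; congr (_ *: _).
  have [l0|/suppl] := eqVneq (l (t |: A)) 0; first by rewrite /a l0 !scale0r mulr0.
  rewrite /a -scalerAr -mpolyXD msetU // => /mnm_lepP le; congr (_ *: 'X_[_]).
  by apply/mnmP => i; have := le i; rewrite !(mnmDE, mnmBE); lia.
have [|be hbe] := ex a.
  move=> A [Aq]; rewrite bda; have [->|/suppz[_ /andP[_ d]]] := eqVneq (z A) 0.
    by rewrite scale0r; apply: in_ideal0.
  by rewrite -mul_mpolyC; apply: divides_in_ideal.
(* If [a] were the boundary of [be] modulo I, the differential of the difference at T would have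
   coefficient 0 at v; yet it equals x^v. *)
have := kdiffB (fun t => 'X_t) a (kdiff (fun t => 'X_t) be) T.
rewrite kdiffK subr0 bda zT scale1r bE addmK => /(congr1 (mcoeff v)).
rewrite mcoeffX eqxx raddf_sum big1 => [/eqP|t tT] /=; first by rewrite eq_sym oner_eq0.
rewrite mulrAC; apply: (@min_gen_coef G) => //; apply: in_idealM; apply: hbe.
by rewrite cardsU1 tT.
Qed.

(** * The depth bound from a single generator *)

Section DepthBound.
Variable G : seq 'X_{1..n}.
Hypothesis uniqG : uniq G.
Hypothesis minG : forall u v, u \in G -> v \in G -> (u <= v)%MM -> u = v.
Hypothesis wpG : forall u v t, u \in G -> v \in G -> agree_below t u v ->
  (v t < u t)%N -> exchangeable G v t.

Let sG := sort (@gen_le n) G.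

(** Since [gen_le] is antisymmetric, the prefix [L1] consists exactly of the other generators
    preceding v, so [linear_quotients] applies. *)
Lemma sorted_lq L1 v L2 m : sG = L1 ++ v :: L2 ->
  divides L1 (v + m) <-> exists2 t, t \in exchange_set G v & (0 < m t)%N.
Proof.
move=> sE; have memG u : (u \in G) = (u \in sG) by rewrite mem_sort.
have vG : v \in G by rewrite memG sE mem_cat inE eqxx orbT.
have srt : sorted (@gen_le n) sG by apply/sort_sorted/gen_le_total.
have uq : uniq sG by rewrite sort_uniq.
rewrite -(linear_quotients minG wpG _ vG); split.
  move=> /dividesP[u uL le]; exists u; split=> //.
  - by rewrite memG sE mem_cat uL.
  - apply: contraTneq uq => uv; rewrite sE cat_uniq -uv; apply/negP => /and3P[_ /negP[]].
    by rewrite /= uL.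
  move: srt; rewrite sE sorted_pairwise; last exact: gen_le_trans.
  rewrite pairwise_cat => /and3P[/allrelP all _ _]; apply: all => //.
  by rewrite inE eqxx.
case=> u [uG uv ruv le]; apply/dividesP; exists u => //.
move: uG; rewrite memG sE mem_cat inE (negbTE uv) /= => /orP[//|uL2].
move: srt; rewrite sE sorted_pairwise; last exact: gen_le_trans.
rewrite pairwise_cat /= => /and3P[_ _ /andP[/allP/(_ u uL2) rvu _]].
have e : mdeg u = mdeg v by apply/eqP; rewrite eqn_leq !gen_le_mdeg.
move: ruv rvu uv; rewrite /gen_le e eqxx ltnn /= => vu uv'.
by rewrite eq_le vu uv'.
Qed.

(** At b = v + T each facet of the simplex T is a face for [L1], as v x_t lies in its ideal, while T
    is not, as v does not. Filling the boundary of T by y within [L1] yields the cycle T - y, a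
    nonzero class in degree #|T| + 1. *)
Lemma exchange_set_bound v (r : nat) : v \in G -> v != 0%MM -> depth_ge K G r ->
  (#|exchange_set G v| + 1 + r <= n)%N.
Proof.
move=> vG v0 [fs [sz [reg _]]]; rewrite leqNgt; apply/negP => nr.
set T := exchange_set G v in nr *.
have vs : v \in sG by rewrite mem_sort.
have [L1 [L2 sE]] : exists L1 L2, sG = L1 ++ v :: L2.
  by case/splitPr: vs => L1 L2; exists L1, L2.
have lqv m := sorted_lq m sE.
pose b := (v + mset T)%MM.
pose dT A : K := (A == T)%:R.
have srt : sorted (@gen_le n) sG by apply/sort_sorted/gen_le_total.
have lq : lq_list (mdeg v) L1.
  move=> M1 w M2 LE; split; last first.
    exists (exchange_set G w) => m; apply: (@sorted_lq M1 w (M2 ++ v :: L2)).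
    by rewrite sE LE -catA.
  move: srt; rewrite sE sorted_pairwise; last exact: gen_le_trans.
  rewrite pairwise_cat => /and3P[/allrelP all _ _]; apply/gen_le_mdeg/all.
    by rewrite LE mem_cat inE eqxx orbT.
  by rewrite inE eqxx.
have [|A||y [suppy zy]] := @koszul_complex_acyclic L1 b (mdeg v) #|T| (bd dT) lq.
- by rewrite mdegD mdeg_mset.
- move=> /bd_neq0[t tA]; rewrite /dT; case: (t |: A =P T) => [TE _|_]; last by rewrite /= eqxx.
  rewrite -TE cardsU1 tA; split=> //.
  have bE : b = (v + U_(t) + mset A)%MM by rewrite /b -TE msetU // addmA.
  rewrite /face bE lem_addl addmK; apply/lqv; exists t; last by rewrite mnm1E eqxx.
  by rewrite -/T -TE setU11.
- exact: kdiffK.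
have TE : (b - mset T = v)%MM by rewrite addmK.
apply: (@koszul_nonexact G b v T (fun A => dT A - y A)) => //.
- by move=> u uG; apply: minG.
- move=> A; rewrite /dT; case: (A =P T) => [->|_].
    by split=> //; rewrite /face TE lem_addl; apply/dividesP; exists v => //; apply: lepm_refl.
  rewrite sub0r oppr_eq0 => /suppy[-> /andP[le /dividesP[u uL ule]]]; split=> //.
  rewrite /face le; apply/dividesP; exists u => //.
  by rewrite -(mem_sort (@gen_le n)) -/sG sE mem_cat uL.
- by move=> A; rewrite /bd kdiffB -/bd zy subrr.
- rewrite /dT eqxx; suff -> : y T = 0 by rewrite subr0.
  apply/eqP/negPn/negP => /suppy[_ /andP[_]]; rewrite TE -[v]addm0.
  by case/lqv => t _; rewrite mnm0E.
by apply: (@regular_koszul_exact _ _ _ _ #|T|.+1 reg); rewrite sz -[#|T|.+1]addn1.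
Qed.

End DepthBound.
End KoszulComplex.

(** * Stanley decompositions by slicing along the variables *)

Lemma count1_unique (T : Type) (x0 : T) (p : pred T) (s : seq T) :
  count p s = 1%N -> exists! k : 'I_(size s), p (nth x0 s k).
Proof.
rewrite -sum1_count big_mkcond (big_nth x0) big_mkord => c1.
have [k pk] : exists k : 'I_(size s), p (nth x0 s k).
  apply/existsP; apply: contra_eqT c1 => /existsPn np.
  by rewrite big1 // => k _; rewrite (negbTE (np k)).
exists k; split=> // l pl; apply: contra_eq c1 => kl.
by rewrite (bigD1 k) // (bigD1 l) 1?eq_sym //= pk pl.
Qed.

Section StanleyDecomposition.
Variables (n : nat) (G : seq 'X_{1..n}).
Implicit Types (u v w m : 'X_{1..n}) (s t : 'I_n) (Z : {set 'I_n}).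
Implicit Types (c : 'X_{1..n} * {set 'I_n}).

Hypothesis minG : forall u v, u \in G -> v \in G -> (u <= v)%MM -> u = v.
Hypothesis wpG : forall u v t, u \in G -> v \in G -> agree_below t u v ->
  (v t < u t)%N -> exchangeable G v t.

(** Decidable membership in a Stanley space, so that an exact cover becomes a statement about
    [count]. *)
Definition covers m c :=
  [forall i, if i \in c.2 then (c.1 i <= m i)%N else m i == c.1 i].

Lemma coversP m c :
  (exists w, supported_in w c.2 /\ m = (c.1 + w)%MM) <-> covers m c.
Proof.
split=> [[w [/forallP sw ->]]|/forallP cov].
  apply/forallP => i; rewrite mnmDE; case: ifPn => [_|iZ]; first exact: leq_addr.
  by have := sw i; rewrite iZ /= => /eqP ->; rewrite addn0.
exists (m - c.1)%MM; split.
  apply/forallP => i; apply/implyP => iZ; have := cov i.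
  by rewrite (negbTE iZ) mnmBE => /eqP ->; rewrite subnn.
apply/mnmP => i; rewrite mnmDE mnmBE; have := cov i.
by case: ifP => _ => [le|/eqP ->]; lia.
Qed.

Lemma covers_self c : covers c.1 c.
Proof. by apply/forallP => i; case: ifP. Qed.

Definition agreeb (i : nat) u v := [forall s : 'I_n, (s < i)%N ==> (u s == v s)].

Lemma agreebP i u v : reflect (agree_below i u v) (agreeb i u v).
Proof.
apply: (iffP forallP) => [uv s si|uv s]; first by have := uv s; rewrite si => /eqP.
by apply/implyP => si; rewrite uv.
Qed.

Lemma agreebS t u v : agreeb t.+1 u v = agreeb t u v && (u t == v t).
Proof.
apply/agreebP/andP => [uv|[/agreebP uv /eqP e] s].
  by split; [apply/agreebP => s st; apply: uv; lia | apply/eqP/uv].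
by rewrite ltnS leq_eqVlt => /orP[/eqP/val_inj ->|/uv].
Qed.

Lemma agreeb_trans i w v m : agreeb i w v -> agreeb i m w = agreeb i m v.
Proof.
by move=> /agreebP wv; apply/agreebP/agreebP => h s si; rewrite h ?wv.
Qed.

(** Exchanging against w0 raises the exponent at t by exactly one and keeps the prefix, so no value
    is skipped. *)
Lemma exponent_gap v w0 w t (d : nat) : v \in G -> w0 \in G -> w \in G ->
  agreeb t w0 v -> agreeb t w v -> (w t <= d <= w0 t)%N ->
  exists w', [/\ w' \in G, agreeb t w' v & w' t = d].
Proof.
move=> vG w0G wG /agreebP w0v; have [k] := ubnP (d - w t).
elim: k w wG => // k IH w wG lek /agreebP wv /andP[wd dw0].
move: wd; rewrite leq_eqVlt => /orP[/eqP wd|wd].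
  by exists w; split=> //; apply/agreebP.
have tw : t \in exchange_set G w.
  rewrite inE; apply: (wpG w0G wG) => [s st|]; first by rewrite w0v ?wv.
  exact: leq_trans wd dw0.
have [u [uG uw ut _ _]] := exchange_gen minG wpG wG tw.
apply: (IH u) => //; rewrite ?ut ?wd //; first by lia.
by apply/agreebP => s st; rewrite uw ?wv.
Qed.

Definition from (i : nat) : {set 'I_n} := [set s : 'I_n | (i <= s)%N].

Lemma card_from t Z : t \in Z -> #|Z :&: from t| = #|Z :&: from t.+1|.+1.
Proof.
move=> tZ; rewrite (cardsD1 t) !inE tZ leqnn /=; congr (_.+1); apply: eq_card => s.
by rewrite !inE ltn_neqAle -val_eqE eq_sym; case: (s \in Z); rewrite ?andbF.
Qed.

Lemma card_fromS t Z : (#|Z :&: from t.+1| <= #|Z :&: from t|)%N.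
Proof. by apply/subset_leq_card/setIS/subsetP => s; rewrite !inE => /ltnW. Qed.

Lemma card_fromT (i : nat) : #|from i| = (n - i)%N.
Proof.
have -> : from i = ~: [set s : 'I_n | (s < i)%N].
  by apply/setP => s; rewrite !inE -leqNgt.
have [le|lt] := leqP i n; last first.
  have -> : [set s : 'I_n | (s < i)%N] = setT.
    by apply/setP => s; rewrite !inE; have := ltn_ord s; lia.
  by rewrite setCT cards0; lia.
rewrite cardsCs setCK card_ord; congr (_ - _)%N.
rewrite -sum1_card (eq_bigl (fun s : 'I_n => (s < i)%N)); last by move=> s; rewrite inE.
by rewrite -(big_ord_widen n (fun=> 1%N)) // sum1_card card_ord.
Qed.

(** The invariant of the slicing: the first i exponents are fixed, and the dimension bound counts
    only the remaining variables. It is written additively to avoid truncated subtraction. *)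
Definition good_cells i v (D : seq ('X_{1..n} * {set 'I_n})) := forall c, c \in D ->
  (forall s, (s < i)%N -> s \notin c.2) /\
  exists w, [/\ w \in G, agreeb i w v &
    (n - i <= #|c.2| + 1 + #|exchange_set G w :&: from i|)%N].

(** Induction on n - i, slicing by the exponent of the variable t of index i. At i = n the only
    candidate monomial is v itself, which lies in I. *)
Lemma slice_decomp i v : (i <= n)%N -> v \in G ->
  exists D, good_cells i v D /\
    forall m, count (covers m) D = ~~ divides G m && agreeb i m v.
Proof.
have [k ik] : exists k, (n - i)%N = k by exists (n - i)%N.
elim: k i v ik => [|k IH] i v nik le_in vG.
  exists [::]; split=> // m; apply/esym/eqP; rewrite eqb0 negb_and negbK orbC -implybE.
  apply/implyP => /agreebP mv; apply/dividesP; exists v => //.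
  by apply/mnm_lepP => s; rewrite mv //; have := ltn_ord s; lia.
have lin : (i < n)%N by lia.
pose t := Ordinal lin.
have {}IH w : w \in G -> exists D, good_cells t.+1 w D /\
    forall m, count (covers m) D = ~~ divides G m && agreeb t.+1 m w.
  by apply: IH => //=; lia.
have vv : agreeb t v v by apply/agreebP.
have [M [w0 [w0G w0v w0M]] maxM] : exists2 M,
    exists w0, [/\ w0 \in G, agreeb t w0 v & w0 t = M] &
    forall w, w \in G -> agreeb t w v -> (w t <= M)%N.
  pose P d := has (fun w => agreeb t w v && (w t == d)) G.
  have exP : exists d, P d.
    by exists (v t); apply/hasP; exists v => //; rewrite vv eqxx.
  have ubP d : P d -> (d <= \max_(w <- G) w t)%N.
    by case/hasP => w wG /andP[_ /eqP <-]; apply: leq_bigmax_seq.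
  case: (ex_maxnP exP ubP) => M /hasP[w0 w0G /andP[w0v /eqP w0M]] maxM.
  exists M; first by exists w0.
  by move=> w wG wv; apply: maxM; apply/hasP; exists w => //; rewrite wv eqxx.
have low d : (d <= M)%N -> exists D, good_cells t v D /\
    forall m, count (covers m) D = ~~ divides G m && agreeb t m v && (m t < d)%N.
  elim: d => [|d IHd] dM; first by exists [::]; split=> // m; rewrite ltn0 andbF.
  have [D [gD cD]] := IHd (ltnW dM).
  suff [D' [gD' cD']] : exists D', good_cells t v D' /\
      forall m, count (covers m) D' = ~~ divides G m && agreeb t m v && (m t == d).
    exists (D ++ D'); split=> [c|m].
      by rewrite mem_cat => /orP[/gD|/gD'].
    rewrite count_cat cD cD' ltnS.
    by case: ltngtP; rewrite ?andbF ?andbT ?addn0.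
  (* If some generator with this prefix has exponent at most d, one has exponent exactly d and
     supplies the prefix for induction. Otherwise no monomial of the slice lies in I. *)
  have [/hasP[w1 w1G /andP[w1v w1d]]|/hasPn nod] :=
      boolP (has (fun w => agreeb t w v && (w t <= d)%N) G).
    have [|w [wG wv wd]] := exponent_gap (d := d) vG w0G w1G w0v w1v.
      by rewrite w1d w0M ltnW.
    have [D' [gD' cD']] := IH w wG; exists D'; split=> [c /gD'[Zc [w' [w'G w'w le]]]|m].
      split=> [s st|]; first by apply: Zc; exact: ltnW.
      move: w'w; rewrite agreebS => /andP[w'w /eqP w't].
      have w'v : agreeb t w' v by rewrite -(agreeb_trans _ wv).
      exists w'; split=> //; change (n - t <= #|c.2| + 1 + #|exchange_set G w' :&: from t|)%N.
      (* The slice loses the variable t, but t also leaves the exchange set: w' has exponent d < M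
         there and can be exchanged against w0. *)
      rewrite card_from; first by rewrite addnS -(subnSK (ltn_ord t)) ltnS.
      rewrite inE; apply: (wpG w0G w'G); last by rewrite w't wd w0M.
      by move=> s st; rewrite (agreebP _ _ _ w0v) ?(agreebP _ _ _ w'v).
    by rewrite cD' agreebS wd (agreeb_trans _ wv) andbA.
  pose u : 'X_{1..n} :=
    [multinom (if (s < t)%N then v s else if s == t then d else 0%N) | s < n].
  exists [:: (u, from t.+1)]; split=> [c|m].
    rewrite inE => /eqP ->; split=> [s st|]; first by rewrite inE /= -leqNgt ltnW.
    by exists v; split=> //=; rewrite card_fromT; lia.
  have -> : count (covers m) [:: (u, from t.+1)] = agreeb t m v && (m t == d) :> nat.
    rewrite /= addn0; congr (nat_of_bool _); apply/forallP/andP => [cov|[/agreebP mv /eqP md] s].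
      split; [apply/agreebP => s st|]; have := cov t; first have := cov s.
        by rewrite inE mnmE /= ltnNge (ltnW st) /= st => /eqP.
      by rewrite inE mnmE ltnn eqxx.
    rewrite inE mnmE; case: (ltngtP t s) => [lt||/val_inj e].
    - by have /negbTE -> : s != t by rewrite -val_eqE /= neq_ltn lt orbT.
    - by move=> lt; rewrite mv.
    - by rewrite -e eqxx md.
  rewrite -andbA; case: andP => [[mv /eqP md]|_]; last by rewrite andbF.
  rewrite andbT; apply/esym/eqP; rewrite eqb1; apply/negP => Gm.
  have [w [wG /mnm_lepP wm wv]] := prefix_gen minG wpG vG Gm (agreebP _ _ _ mv).
  by have := nod w wG; rewrite -md wm andbT; case/negP; apply/agreebP.
have [D [gD cD]] := low M (leqnn M).
have [D' [gD' cD']] := IH w0 w0G.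
(* All slices from M on are copies of the slice at M, so its cells gain x_t as a free variable. *)
pose ext c := (c.1, t |: c.2) : 'X_{1..n} * {set 'I_n}.
exists (D ++ map ext D'); split=> [c|m].
  rewrite mem_cat => /orP[/gD//|/mapP[[u Z] /gD'[Zc [w [wG ww0 le]]] ->]] /=.
  split=> [s st|].
    rewrite in_setU1 negb_or Zc ?ltnS ?(ltnW st) // andbT -val_eqE /=; move: st => /=; lia.
  exists w; split=> //.
    by move: ww0; rewrite agreebS -(agreeb_trans _ w0v) => /andP[].
  change (n - t <= #|t |: Z| + 1 + #|exchange_set G w :&: from t|)%N.
  rewrite cardsU1 Zc // add1n !addSn -(subnSK (ltn_ord t)) ltnS (leq_trans le) //.
  by rewrite leq_add2l card_fromS.
rewrite count_cat cD count_map.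
(* Projection of m to the slice at M. For exponent at least M it preserves membership in I, since
   generators with this prefix have exponent at most M at t. *)
pose m' : 'X_{1..n} := [multinom (if s == t then M else m s) | s < n].
have m'E s : m' s = if s == t then M else m s by rewrite mnmE.
have -> : count (preim ext (covers m)) D' = ((M <= m t)%N && (0 < count (covers m') D')%N) :> nat.
  transitivity (count (fun c => (M <= m t)%N && covers m' c) D').
    apply: eq_in_count => -[u Z] uZD; have [/= Zc _] := gD' _ uZD.
    have tZ : t \notin Z by apply: Zc.
    have ut : u t = M.
      have : (0 < count (covers u) D')%N.
        by rewrite -has_count; apply/hasP; exists (u, Z) => //; apply: (covers_self (u, Z)).
      by rewrite cD' agreebS lt0b => /and3P[_ _ /eqP ->].
    apply/forallP/andP => [cov|[Mm /forallP cov] s] /=.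
      split; first by have := cov t; rewrite /= in_setU1 eqxx ut.
      apply/forallP => s /=; have := cov s; rewrite /= in_setU1 m'E.
      by case: (s =P t) => [->|_] //; rewrite (negbTE tZ) ut eqxx.
    have := cov s; rewrite /= in_setU1 m'E.
    by case: (s =P t) => [->|_] //; rewrite ut Mm.
  case: (M <= m t)%N; rewrite /= ?count_pred0 //.
  by rewrite cD'; case: (_ && _).
rewrite cD' lt0b agreebS m'E eqxx w0M eqxx andbT.
have -> : agreeb t m' w0 = agreeb t m v.
  rewrite (agreeb_trans _ w0v); apply/agreebP/agreebP => h s st; have := h s st;
  by rewrite m'E; have /negbTE -> : s != t by rewrite -val_eqE /= neq_ltn st.
case: agreebP => [mv|_]; rewrite ?andbF ?andbT //.
case: leqP => [Mm|_]; rewrite ?andbF ?andbT ?addn0 //= add0n.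
congr (nat_of_bool (~~ _)); apply/idP/idP => Gm.
  apply: divides_lem Gm _; apply/mnm_lepP => s; rewrite m'E.
  by case: (s =P t) => [->|].
have [w [wG /mnm_lepP wm wv]] := prefix_gen minG wpG vG Gm mv.
apply/dividesP; exists w => //; apply/mnm_lepP => s; rewrite m'E.
by case: (s =P t) => [->|//]; apply: maxM => //; apply/agreebP.
Qed.

End StanleyDecomposition.

(* I = (x^g : g in G) with G = G(I), I proper, weakly polymatroidal.
   depth(S/I) <= sdepth(S/I), stated as: depth >= r implies sdepth >= r. *)
Theorem theorem2p3 (K : fieldType) (n : nat) (G : seq 'X_{1..n}) :
  minimal_gens G ->
  ~ mon_in K G (0%MM) ->
  weakly_polymatroidal K G ->
  forall r : nat, depth_ge K G r -> sdepth_ge K G r.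
Proof.
move=> [uniqG minG] proper wp r depth.
have minG' u v : u \in G -> v \in G -> (u <= v)%MM -> u = v by apply: minG.
have wpG u v (t : 'I_n) : u \in G -> v \in G -> agree_below t u v -> (v t < u t)%N ->
    exchangeable G v t.
  move=> uG vG uv lt; have [j [tj vj /mon_inP Gm]] := wp u v uG vG t uv lt.
  by apply/existsP; exists j; rewrite tj vj.
have [D [rD cD]] : exists D : seq ('X_{1..n} * {set 'I_n}),
    (forall c, c \in D -> (r <= #|c.2|)%N) /\
    forall m, count (covers m) D = ~~ divides G m.
  (* For I = 0 the whole ring is one Stanley space. Otherwise the slicing starts from the empty
     prefix of any generator. *)
  have [G0|[v vG]] : G = [::] \/ exists v, v \in G.
    by case: (G) => [|v G0]; [left | right; exists v; rewrite inE eqxx].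
    exists [:: (0%MM, setT)]; split=> [c|m].
      by rewrite inE => /eqP -> /=; rewrite cardsT card_ord; apply: depth_ge_le depth.
    rewrite G0 /= addn0; apply/eqP; rewrite eqb1; apply/forallP => i.
    by rewrite inE mnm0E.
  have [D [gD cD]] := slice_decomp minG' wpG (leq0n n) vG.
  exists D; split=> [c /gD[_ [w [wG _ le]]]|m]; last first.
    by rewrite cD; case: agreebP => [_|[]//]; rewrite andbT.
  have w0 : w != 0%MM.
    apply/eqP => w0; apply: proper; apply/mon_inP/dividesP; exists 0%MM; rewrite ?lepm_refl //.
    by rewrite -w0.
  (* Both bounds are compared cell by cell at the generator w attached to the cell, so no maximum
     over G(I) is formed. *)
  rewrite -(leq_add2l (#|exchange_set G w| + 1)).
  apply: leq_trans (exchange_set_bound uniqG minG' wpG wG w0 depth) _.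
  rewrite subn0 in le; apply: leq_trans le _.
  by rewrite addnC addnA addnAC !leq_add2r subset_leq_card ?subsetIl.
exists D; split=> //; split=> [c cinD w sw /mon_inP Gm|m nGm].
  have : (0 < count (covers (c.1 + w)%MM) D)%N.
    by rewrite -has_count; apply/hasP; exists c => //; apply/coversP; exists w.
  by rewrite cD Gm.
have c1 : count (covers m) D = 1%N.
  by rewrite cD; have /negP -> : ~ divides G m by move=> Gm; apply/nGm/mon_inP.
have [k [ck uk]] := count1_unique (0%MM, set0) c1.
exists k; split=> [|l /coversP cl]; first exact/coversP.
exact: uk.
Qed.
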